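(* Let $\mathbb X,\mathbb Y$ be Hilbert spaces over $\mathbb K\in\{\mathbb R,\mathbb C\}$, let $\mathbf A\colon\mathbb X\to\mathbb Y$ be a bounded linear operator, let $(\mathbf U,\mathbf V,\boldsymbol\kappa)=(u_\lambda,v_\lambda,\kappa_\lambda)_{\lambda\in\Lambda}$ be a singular value decomposition (SVD) for $\mathbf A$, let $\boldsymbol d=(d_\lambda)_{\lambda\in\Lambda}\in\mathbb R^\Lambda$ satisfy $\inf_{\lambda\in\Lambda} d_\lambda>0$, let $\alpha>0$, and let $y_\delta\in\mathbb Y$. Define the sets $$\mathbf B_\alpha^{\rm ANA}(y_\delta):=\operatorname*{arg\,min}_{x\in\mathbb X}\Big\{\tfrac12\|\mathbf A x-y_\delta\|^2+\alpha\sum_{\lambda\in\Lambda}d_\lambda|\langle x,u_\lambda\rangle|\Big\},$$ $$\mathbf B_\alpha^{\rm SYN}(y_\delta):=\mathbf U\Big(\operatorname*{arg\,min}_{\xi\in\ell^2(\Lambda)}\Big\{\tfrac12\|\mathbf A\mathbf U\xi-y_\delta\|^2+\alpha\sum_{\lambda\in\Lambda}d_\lambda|\xi_\lambda|\Big\}\Big).$$ Then $$\mathbf B_\alpha^{\rm ANA}(y_\delta)=\mathbf B_\alpha^{\rm SYN}(y_\delta)=\big\{(\mathbf U\circ\mathbf M_{\boldsymbol\kappa}^{+}\circ\mathbb S_{\alpha\boldsymbol d/\boldsymbol\kappa}\circ\mathbf V^* )(y_\delta)\big\}.$$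
   Context: An SVD for $\mathbf A$ is a family $(u_\lambda,v_\lambda,\kappa_\lambda)_{\lambda\in\Lambda}$ such that $(u_\lambda)_{\lambda\in\Lambda}$ is an orthonormal basis of $\mathbb X$, $(v_\lambda)_{\lambda\in\Lambda}$ is an orthonormal basis of $\overline{\operatorname{ran}(\mathbf A)}\subseteq\mathbb Y$, and for all $\lambda$, $\kappa_\lambda>0$ and $\mathbf A^*v_\lambda=\kappa_\lambda u_\lambda$. $\mathbf U\colon\ell^2(\Lambda)\to\mathbb X$, $\xi\mapsto\sum_\lambda\xi_\lambda u_\lambda$ is the synthesis operator of $(u_\lambda)_\lambda$; $\mathbf V$ is the synthesis operator of $(v_\lambda)_\lambda$, and its adjoint is $\mathbf V^*\colon\mathbb Y\to\ell^2(\Lambda)$, $y\mapsto(\langle y,v_\lambda\rangle)_{\lambda}$ (inner products are linear in the first argument). The sums $\sum_\lambda d_\lambda|\cdot|$ are understood as $+\infty$ when they diverge. $\mathbf B_\alpha^{\rm SYN}(y_\delta)$ is the image under $\mathbf U$ of the set of minimizers. Soft-thresholding: for $\eta\in\mathbb K$ and $d\ge 0$, $\operatorname{soft}(\eta,d):=\operatorname{sign}(\eta)\max\{0,|\eta|-d\}$ with $\operatorname{sign}(\eta)=\eta/|\eta|$ for $\eta\ne0$ and $\operatorname{sign}(0)=0$; for families, $\mathbb S_{\boldsymbol d}(\boldsymbol\eta):=(\operatorname{soft}(\eta_\lambda,d_\lambda))_{\lambda}$. Here $\alpha\boldsymbol d/\boldsymbol\kappa=(\alpha d_\lambda/\kappa_\lambda)_\lambda$.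 $\mathbf M_{\boldsymbol\kappa}^+$ is pointwise division, $(\mathbf M_{\boldsymbol\kappa}^+\boldsymbol\eta)_\lambda=\eta_\lambda/\kappa_\lambda$. *)

(* Defs.v *)
From HB Require Import structures.
From mathcomp Require Import all_boot all_order all_algebra finmap.
From mathcomp Require Import complex.
From mathcomp Require Import all_classical all_reals all_analysis.

Set Implicit Arguments.
Unset Strict Implicit.
Unset Printing Implicit Defensive.

Import Order.TTheory GRing.Theory Num.Theory.
Import numFieldNormedType.Exports.

Local Open Scope classical_set_scope.
Local Open Scope ring_scope.

Variant scalar_kind := RealScalars | ComplexScalars.

(* The scalar field K, which is R itself or R[i]. *)
Definition scalar_field (R : realType) (k : scalar_kind) : numFieldType :=
  match k with
  | RealScalars => R : numFieldType
  | ComplexScalars => R[i] : numFieldType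
  end.

Definition conj (R : realType) (k : scalar_kind) : scalar_field R k -> scalar_field R k :=
  match k with
  | RealScalars => fun z : R => z
  | ComplexScalars => fun z : R[i] => conjc z
  end.

Definition of_real {R : realType} {k : scalar_kind} : R -> scalar_field R k :=
  match k with
  | RealScalars => fun r : R => r
  | ComplexScalars => fun r : R => real_complex R r
  end.

Definition real_part {R : realType} {k : scalar_kind} : scalar_field R k -> R :=
  match k with
  | RealScalars => fun z : R => z
  | ComplexScalars => fun z : R[i] => complex.Re z
  end.

(* [{dot X for conj}] is linear in its first argument and conjugate-linear in
   its second one. *)
HB.mixin Record CompleteNormedModule_isHilbert (R : realType)
    (k : scalar_kind) (X : Type) of CompleteNormedModule (scalar_field R k) X := {
  inner : {dot X for @conj R k} ;
  innerxx : forall x : X, inner x x = `|x| ^+ 2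
}.

#[short(type="hilbertType")]
HB.structure Definition Hilbert (R : realType) (k : scalar_kind) :=
  {X of CompleteNormedModule_isHilbert R k X
      & CompleteNormedModule (scalar_field R k) X}.

(* Norms in the library take values in the scalar field, where the norm of a
   vector is a nonnegative real; [rnorm] is the same norm with values in R. *)
Definition rnorm {R : realType} {k : scalar_kind}
    {V : normedZmodType (scalar_field R k)} (x : V) : R := real_part `|x|.

Section Operators.
Context {R : realType} {k : scalar_kind} {X Y : hilbertType R k}.

Definition bounded_operator (A : X -> Y) : Prop :=
  exists M : R, forall x, rnorm (A x) <= M * rnorm x.

(* For a bounded linear [A] the set below is a singleton, by the Riesz
   representation theorem. *)
Definition adjoint (A : X -> Y) (y : Y) : X :=
  get [set z | forall x, inner (A x) y = inner x z].

End Operators.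

Section Families.
Context {R : realType} {k : scalar_kind} {X : hilbertType R k} {L : choiceType}.
Local Notation K := (scalar_field R k).

Definition orthonormal_family (u : L -> X) : Prop :=
  forall i j, inner (u i) (u j) = (i == j)%:R.

Definition linear_span (u : L -> X) : set X :=
  [set x | exists (F : {fset L}) (c : L -> K), x = \sum_(i <- F) c i *: u i].

Definition orthonormal_basis (u : L -> X) (W : set X) : Prop :=
  orthonormal_family u /\ closure (linear_span u) = W.

Definition ell2 : set (L -> K) :=
  [set xi | (\esum_(l in [set: L]) (rnorm (xi l : K) ^+ 2)%:E < +oo)%E].

(* Finite subsets of the index set, directed by inclusion: convergence along
   this filter is unconditional summability. *)
Definition fset_filter : set_system {fset L} :=
  filter_from [set: {fset L}] (fun F => [set G | fsubset F G]).

#[global] Instance fset_filter_proper : ProperFilter fset_filter.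
Proof.
apply: filter_from_proper => [|F _]; last by exists F => /=.
apply: filter_from_filter => [|F G _ _]; first by exists fset0.
by exists (F `|` G)%fset => // H /=; rewrite fsubUset => /andP.
Qed.

Definition synthesis (u : L -> X) (xi : L -> K) : X :=
  lim ((fun F : {fset L} => \sum_(l <- F) xi l *: u l) @ fset_filter).

(* The adjoint of [synthesis u]. *)
Definition analysis (u : L -> X) (x : X) : L -> K :=
  fun l => inner x (u l).

End Families.

Record is_svd {R : realType} {k : scalar_kind} {X Y : hilbertType R k}
    {L : choiceType} (A : X -> Y) (u : L -> X) (v : L -> Y) (kappa : L -> R)
    : Prop := IsSVD {
  svd_left : orthonormal_basis u [set: X] ;
  svd_right : orthonormal_basis v (closure (range A)) ;
  svd_gt0 : forall l, 0 < kappa l ;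
  svd_adjoint : forall l, adjoint A (v l) = of_real (kappa l) *: u l
}.

Section Thresholding.
Context {R : realType} {k : scalar_kind} {L : choiceType}.
Local Notation K := (scalar_field R k).

Definition sign (eta : K) : K := if eta == 0 then 0 else eta / `|eta|.

Definition soft (eta : K) (t : R) : K :=
  sign eta * of_real (Num.max 0 (rnorm eta - t)).

Definition soft_thresholding (t : L -> R) (eta : L -> K) : L -> K :=
  fun l => soft (eta l) (t l).

Definition mul_pinv (kappa : L -> R) (eta : L -> K) : L -> K :=
  fun l => eta l / of_real (kappa l).

Definition mul_pinv_dom (kappa : L -> R) : set (L -> K) :=
  [set eta | ell2 eta /\ ell2 (mul_pinv kappa eta)].

End Thresholding.

Definition argmin_set {R : realType} {T : Type} (D : set T) (f : T -> \bar R)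
    : set T :=
  [set x | D x /\ forall y, D y -> (f x <= f y)%E].

Section Estimators.
Context {R : realType} {k : scalar_kind} {X Y : hilbertType R k} {L : choiceType}.
Local Notation K := (scalar_field R k).

Definition B_ana (A : X -> Y) (u : L -> X) (d : L -> R) (alpha : R)
    (ydelta : Y) : set X :=
  argmin_set [set: X] (fun x =>
    (2^-1 * rnorm (A x - ydelta) ^+ 2)%:E +
    alpha%:E * \esum_(l in [set: L]) (d l * rnorm (inner x (u l)))%:E)%E.

Definition B_syn (A : X -> Y) (u : L -> X) (d : L -> R) (alpha : R)
    (ydelta : Y) : set X :=
  synthesis u @` argmin_set ell2 (fun xi : L -> K =>
    (2^-1 * rnorm (A (synthesis u xi) - ydelta) ^+ 2)%:E +
    alpha%:E * \esum_(l in [set: L]) (d l * rnorm (xi l))%:E)%E.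

End Estimators.

(* Main.v *)
(* By the Riesz representation theorem, A^* v_l = kappa_l u_l gives
   <A x, v_l> = kappa_l <x, u_l>, hence A u_l = kappa_l v_l because A u_l lies
   in the closed span of v.  On the span of finitely many u_l the objective
   therefore splits, up to a constant, into the scalar problems
   |a - y_l|^2 / 2 + t_l |a| with a = kappa_l x_l and t_l = alpha d_l / kappa_l,
   whose minimizer is soft(y_l, t_l).  Strong convexity of each scalar problem,
   summed over finite index sets and passed to the limit, yields
     Phi(x0) + |A (x - x0)|^2 / 2 <= Phi(x)
   for x0 = U xi with xi_l = soft(y_l, t_l) / kappa_l, and A is injective.
   The synthesis problem is the analysis problem transported along the
   isometry U. *)
From HB Require Import structures.
Require Import Defs.
From mathcomp Require Import all_boot all_order all_algebra.
From mathcomp Require Import finmap complex ring lra.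
From mathcomp Require Import all_classical all_reals all_analysis.

Set Implicit Arguments.
Unset Strict Implicit.
Unset Printing Implicit Defensive.

Import Order.TTheory GRing.Theory Num.Theory.
Import numFieldNormedType.Exports.

Local Open Scope classical_set_scope.
Local Open Scope ring_scope.

(** * The scalar field and real-valued norms *)

Section Scalars.
Context {R : realType} {k : scalar_kind}.
Local Notation K := (scalar_field R k).
Implicit Types (a b z : K) (r s : R).

(** With [of_real] and [conj] registered as ring morphisms and [real_part] as an additive map, case
    distinctions on [k] stay inside this section. *)
Lemma of_real_is_zmod_morphism : zmod_morphism (@of_real R k).
Proof. by case: k => r s //=; rewrite rmorphB. Qed.

Lemma of_real_is_monoid_morphism : monoid_morphism (@of_real R k).
Proof. by case: k; split => //= r s; rewrite rmorphM. Qed.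

HB.instance Definition _ :=
  GRing.isZmodMorphism.Build R K (@of_real R k) of_real_is_zmod_morphism.
HB.instance Definition _ :=
  GRing.isMonoidMorphism.Build R K (@of_real R k) of_real_is_monoid_morphism.

Lemma conj_is_zmod_morphism : zmod_morphism (@conj R k).
Proof. by case: k => r s //=; rewrite rmorphB. Qed.

Lemma conj_is_monoid_morphism : monoid_morphism (@conj R k).
Proof.
by case: k; split => //=; [rewrite oppr0 | move=> r s; rewrite rmorphM].
Qed.

HB.instance Definition _ :=
  GRing.isZmodMorphism.Build K K (@conj R k) conj_is_zmod_morphism.
HB.instance Definition _ :=
  GRing.isMonoidMorphism.Build K K (@conj R k) conj_is_monoid_morphism.

Lemma real_part_is_zmod_morphism : zmod_morphism (@real_part R k).
Proof. by case: k => // -[a b] [c d]. Qed.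

HB.instance Definition _ :=
  GRing.isZmodMorphism.Build K R (@real_part R k) real_part_is_zmod_morphism.

Lemma real_part_of_real r : real_part (of_real r : K) = r.
Proof. by case: k. Qed.

Lemma real_part_conj z : real_part (conj z) = real_part z.
Proof. by case: k z => // -[]. Qed.

Lemma conjK z : conj (conj z) = z.
Proof. by case: k z => // -[a b] /=; rewrite opprK. Qed.

Lemma conj_of_real r : conj (of_real r) = of_real r :> K.
Proof. by case: k => //=; rewrite oppr0. Qed.

Lemma real_partZ r z : real_part (of_real r * z) = r * real_part z.
Proof. by case: k z => // -[a b] /=; rewrite mul0r subr0. Qed.

Lemma ler_of_real r s : (of_real r <= of_real s :> K) = (r <= s).
Proof. by case: k => //=; rewrite lecR. Qed.

Lemma ltr_of_real r s : (of_real r < of_real s :> K) = (r < s).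
Proof. by case: k => //=; rewrite ltcR. Qed.

(** The order of [R[i]] compares only scalars with equal imaginary parts, so a nonnegative scalar is
    real. *)
Lemma real_partK z : 0 <= z -> z = of_real (real_part z).
Proof. by case: k z => // -[a b] /=; rewrite lecE /= => /andP[/eqP -> _]. Qed.

Lemma mul_conj z : z * conj z = of_real (rnorm z ^+ 2).
Proof.
rewrite /rnorm; case: k z => [z|[a b]] /=.
  by rewrite real_normK ?num_real.
rewrite sqr_sqrtr ?addr_ge0 ?sqr_ge0 //; apply/eqP; rewrite eq_complex /=.
by apply/andP; split; apply/eqP; ring.
Qed.

Lemma add_conj z : z + conj z = of_real (2 * real_part z).
Proof.
case: k z => [z|[a b]] /=; first by ring.
by apply/eqP; rewrite eq_complex /=; apply/andP; split; apply/eqP; ring.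
Qed.

Lemma real_part_le_norm z : `|real_part z| <= rnorm z.
Proof.
rewrite /rnorm; case: k z => [z|[a b]] //=.
by rewrite -sqrtr_sqr ler_wsqrtr // lerDl sqr_ge0.
Qed.

End Scalars.

Section RealNorm.
Context {R : realType} {k : scalar_kind}.
Local Notation K := (scalar_field R k).

Lemma norm_rnorm (V : normedZmodType K) (x : V) : `|x| = of_real (rnorm x).
Proof. by rewrite /rnorm -real_partK. Qed.

Lemma rnorm_ge0 (V : normedZmodType K) (x : V) : 0 <= rnorm x.
Proof. by rewrite -(@ler_of_real _ k) -norm_rnorm rmorph0. Qed.

Lemma rnorm_eq0 (V : normedZmodType K) (x : V) : (rnorm x == 0) = (x == 0).
Proof. by rewrite -[x == 0]normr_eq0 norm_rnorm fmorph_eq0. Qed.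

Lemma rnorm0 (V : normedZmodType K) : rnorm (0 : V) = 0.
Proof. by apply/eqP; rewrite rnorm_eq0. Qed.

Lemma rnormN (V : normedZmodType K) (x : V) : rnorm (- x) = rnorm x.
Proof. by rewrite /rnorm normrN. Qed.

Lemma rnormD (V : normedZmodType K) (x y : V) :
  rnorm (x + y) <= rnorm x + rnorm y.
Proof.
by rewrite -(@ler_of_real _ k) rmorphD /= -!norm_rnorm ler_normD.
Qed.

Lemma rnormM (a b : K) : rnorm (a * b) = rnorm a * rnorm b.
Proof.
by apply: (fmorph_inj (@of_real R k)); rewrite rmorphM /= -!norm_rnorm normrM.
Qed.

Lemma rnormZ (V : normedModType K) (a : K) (x : V) :
  rnorm (a *: x) = rnorm a * rnorm x.
Proof.
by apply: (fmorph_inj (@of_real R k)); rewrite rmorphM /= -!norm_rnorm normrZ.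
Qed.

Lemma rnorm_of_real (r : R) : 0 <= r -> rnorm (of_real r : K) = r.
Proof.
move=> r0; rewrite /rnorm ger0_norm ?real_part_of_real //.
by rewrite -(rmorph0 (@of_real R k)) ler_of_real.
Qed.

Lemma ler_dist_rnorm (V : normedZmodType K) (x y : V) :
  `|rnorm x - rnorm y| <= rnorm (x - y).
Proof.
have := rnormD (x - y) y; have := rnormD (y - x) x; rewrite !subrK.
by rewrite -(rnormN (y - x)) opprB ler_norml => *; apply/andP; split; lra.
Qed.

(** A positive element of [K] is the image of a positive real, so real radii suffice. *)
Lemma cvg_rnormP (V : normedModType K) (T : Type) (F : set_system T)
    {FF : Filter F} (f : T -> V) (x : V) :
  f @ F --> x <->
  forall e : R, 0 < e -> \forall t \near F, rnorm (x - f t) < e.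
Proof.
split=> [/cvgrPdist_lt fx e e0|fx].
  have /fx : 0 < of_real e :> K.
    by rewrite -(rmorph0 (@of_real R k)) ltr_of_real.
  by apply: filterS => t; rewrite norm_rnorm ltr_of_real.
apply/cvgrPdist_lt => e e0; rewrite (real_partK (ltW e0)).
have /fx : 0 < real_part e.
  by rewrite -(@ltr_of_real _ k) rmorph0 -real_partK // ltW.
by apply: filterS => t; rewrite norm_rnorm ltr_of_real.
Qed.

Lemma cvg_rnorm (V : normedModType K) (T : Type) (F : set_system T)
    {FF : Filter F} (f : T -> V) (x : V) :
  f @ F --> x -> rnorm (f t) @[t --> F] --> rnorm x.
Proof.
move=> /cvg_rnormP fx; apply/cvgrPdist_lt => e /fx.
by apply: filterS => t; apply: le_lt_trans; exact: ler_dist_rnorm.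
Qed.

Lemma closure_rnormP (V : normedModType K) (S : set V) (x : V) :
  closure S x <-> forall e : R, 0 < e -> exists2 s, S s & rnorm (x - s) < e.
Proof.
split=> [clS e e0|H].
  have [] := clS [set y | rnorm (x - y) < e].
    exact: (cvg_rnormP (F := nbhs x) (fun y => y) x).1.
  by move=> s [Ss xs]; exists s.
move=> B /nbhs_normP[e /= e0 eB].
have /H[s Ss xs] : 0 < real_part e.
  by rewrite -(@ltr_of_real _ k) rmorph0 -real_partK // ltW.
exists s; split=> //; apply: eB.
by rewrite /= norm_rnorm (real_partK (ltW e0)) ltr_of_real.
Qed.

End RealNorm.

(** * Inner products and finite orthonormal expansions *)

Section HilbertSpace.
Context {R : realType} {k : scalar_kind} {H : hilbertType R k}.
Local Notation K := (scalar_field R k).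
Implicit Types x y : H.

Lemma inner_conj x y : inner x y = conj (inner y x).
Proof. by rewrite [LHS]hermC expr0 mul1r. Qed.

Lemma innerBl x y z : inner (x - y) z = inner x z - inner y z.
Proof. exact: linearBl. Qed.

Lemma inner_suml (I : Type) (r : seq I) (f : I -> H) y :
  inner (\sum_(i <- r) f i) y = \sum_(i <- r) inner (f i) y.
Proof. exact: linear_sumlz. Qed.

Lemma innerZl (a : K) x y : inner (a *: x) y = a * inner x y.
Proof. exact: linearZl_LR. Qed.

Lemma innerZr (a : K) x y : inner x (a *: y) = conj a * inner x y.
Proof. exact: linearZr_LR. Qed.

Lemma inner_rnorm x : inner x x = of_real (rnorm x ^+ 2).
Proof. by rewrite innerxx norm_rnorm rmorphXn. Qed.

Lemma rnormB_sqr x y :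
  rnorm (x - y) ^+ 2 =
  rnorm x ^+ 2 - 2 * real_part (inner x y) + rnorm y ^+ 2.
Proof.
have <- : real_part (inner (x - y) (x - y)) = rnorm (x - y) ^+ 2.
  by rewrite inner_rnorm real_part_of_real.
rewrite innerBl !linearBr /= !inner_rnorm (inner_conj y x) !raddfB /=.
rewrite real_part_conj !real_part_of_real; ring.
Qed.

Lemma rnorm_conj (a : K) : rnorm (conj a) = rnorm a.
Proof.
apply/eqP; rewrite -(eqrXn2 (n := 2)) ?rnorm_ge0 //.
by rewrite -(inj_eq (fmorph_inj (@of_real R k))) /= -!mul_conj conjK mulrC.
Qed.

Lemma rnormB_sqr_scalar (a b : K) :
  rnorm (a - b) ^+ 2 =
  rnorm a ^+ 2 - 2 * real_part (a * conj b) + rnorm b ^+ 2.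
Proof.
apply: (fmorph_inj (@of_real R k)) => /=.
rewrite rmorphD rmorphB /= -!mul_conj -add_conj.
rewrite !(rmorphB, rmorphM) /= conjK; ring.
Qed.

Lemma cauchy_schwarz x y : rnorm (inner x y) <= rnorm x * rnorm y.
Proof.
have [->|y0] := eqVneq y 0; first by rewrite linear0r !rnorm0 mulr0.
have ny0 : 0 < rnorm y by rewrite lt_def rnorm_eq0 y0 rnorm_ge0.
(* [c *: y] is the orthogonal projection of [x] onto the line of [y]; nonnegativity of its squared
   distance to [x] is the squared claim divided by [rnorm y ^+ 2]. *)
pose c := of_real ((rnorm y ^+ 2)^-1) * inner x y.
have := sqr_ge0 (rnorm (x - c *: y)); rewrite rnormB_sqr rnormZ.
rewrite innerZr /c rmorphM /= conj_of_real -mulrA [conj _ * _]mulrC mul_conj.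
rewrite -rmorphM /= real_part_of_real rnormM rnorm_of_real; last first.
  by rewrite invr_ge0 sqr_ge0.
set N := rnorm y in ny0 *; set p := rnorm (inner x y).
have -> : rnorm x ^+ 2 - 2 * ((N ^+ 2)^-1 * p ^+ 2) + ((N ^+ 2)^-1 * p * N) ^+ 2
   = ((rnorm x * N) ^+ 2 - p ^+ 2) / N ^+ 2 by field; rewrite gt_eqF.
rewrite pmulr_lge0 ?invr_gt0 ?exprn_gt0 // subr_ge0 ler_sqr //.
  by rewrite nnegrE rnorm_ge0.
by rewrite nnegrE mulr_ge0 ?rnorm_ge0.
Qed.

(** * Finite orthonormal sums: Bessel's inequality and best approximation *)

Section PartialSums.
Context {L : choiceType} (u : L -> H).
Local Notation psum xi F := (\sum_(i <- F) xi i *: u i).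

Lemma inner_psuml (xi : L -> K) (F : {fset L}) y :
  inner (psum xi F) y = \sum_(i <- F) xi i * conj (inner y (u i)).
Proof.
rewrite inner_suml; apply: eq_bigr => i _.
by rewrite innerZl inner_conj.
Qed.

Hypothesis u_on : orthonormal_family u.

Lemma inner_psum (xi : L -> K) (F : {fset L}) j :
  inner (psum xi F) (u j) = if j \in F then xi j else 0.
Proof.
rewrite inner_psuml; under eq_bigr do rewrite u_on.
case: ifPn => jF.
  rewrite (big_fsetD1 j) //= eqxx rmorph1 mulr1 big_seq big1 ?addr0 // => i.
  by rewrite !inE eq_sym => /andP[/negbTE -> _]; rewrite rmorph0 mulr0.
rewrite big_seq big1 // => i iF; have [ji|] := eqVneq j i.
  by rewrite ji iF in jF.
by rewrite rmorph0 mulr0.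
Qed.

Lemma rnorm_psum (xi : L -> K) (F : {fset L}) :
  rnorm (psum xi F) ^+ 2 = \sum_(i <- F) rnorm (xi i) ^+ 2.
Proof.
apply: (fmorph_inj (@of_real R k)) => /=.
rewrite -inner_rnorm inner_psuml rmorph_sum /= big_seq [RHS]big_seq.
by apply: eq_bigr => i iF; rewrite inner_psum iF mul_conj.
Qed.

(** Completing the square in each coordinate isolates [rnorm y ^+ 2], which does not depend on [xi].
    Bessel's inequality, best approximation and the splitting of the data term all rest on this
    identity. *)
Lemma rnorm_sub_psum (xi : L -> K) (F : {fset L}) y :
  rnorm (psum xi F - y) ^+ 2 =
  rnorm y ^+ 2 + \sum_(i <- F) (rnorm (xi i - inner y (u i)) ^+ 2
                                - rnorm (inner y (u i)) ^+ 2).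
Proof.
rewrite rnormB_sqr rnorm_psum inner_psuml raddf_sum mulr_sumr -sumrB addrC.
by congr (_ + _); apply: eq_bigr => i _ /=; rewrite rnormB_sqr_scalar; ring.
Qed.

Lemma bessel (F : {fset L}) y :
  \sum_(i <- F) rnorm (inner y (u i)) ^+ 2 <= rnorm y ^+ 2.
Proof.
have := sqr_ge0 (rnorm (psum (fun i => inner y (u i)) F - y)).
rewrite rnorm_sub_psum; under eq_bigr do rewrite subrr rnorm0 expr0n /= sub0r.
by rewrite sumrN subr_ge0.
Qed.

(** By [rnorm_sub_psum] the two sides differ only in the squares of [xi i - inner y (u i)], which
    vanish for the coefficients of [y]. *)
Lemma psum_best_approximation (xi : L -> K) (F : {fset L}) y :
  rnorm (psum (analysis u y) F - y) <= rnorm (psum xi F - y).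
Proof.
rewrite -ler_sqr ?nnegrE ?rnorm_ge0 // !rnorm_sub_psum lerD2l.
apply: ler_sum => i _; rewrite lerD2r /analysis subrr rnorm0 expr0n /=.
exact: sqr_ge0.
Qed.

End PartialSums.
End HilbertSpace.

(** * Unconditional summation *)

Lemma fset_sum_le_esum (R : realType) (L : choiceType) (f : L -> R)
    (F : {fset L}) :
  ((\sum_(i <- F) f i)%:E <= \esum_(i in [set: L]) (f i)%:E)%E.
Proof.
apply: ereal_sup_ubound; exists [set` F] => //.
by rewrite fsbig_finite // set_fsetK sumEFin.
Qed.

Lemma esum_le_fset_sums (R : realType) (L : choiceType) (f : L -> R)
    (b : \bar R) :
  (forall F : {fset L}, (\sum_(i <- F) f i)%:E <= b)%E ->
  (\esum_(i in [set: L]) (f i)%:E <= b)%E.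
Proof.
move=> fb; apply: ge_ereal_sup => _ [A [finA _] <-].
by rewrite fsbig_finite // sumEFin.
Qed.

(** The sum is the supremum of its finite subsums: [F0] comes within [e] of it, and it bounds every
    other subsum. This serves as a Cauchy criterion. *)
Lemma esum_adherent (R : realType) (L : choiceType) (f : L -> R) (e : R) :
  (forall i, 0 <= f i) -> (\esum_(i in [set: L]) (f i)%:E < +oo)%E -> 0 < e ->
  exists F0 : {fset L}, forall F : {fset L}, (F0 `<=` F)%fset ->
    \sum_(i <- F) f i < \sum_(i <- F0) f i + e.
Proof.
move=> f0 fltoo e0.
have ffin : \esum_(i in [set: L]) (f i)%:E \is a fin_num.
  by rewrite ge0_fin_numE // esum_ge0 // => i _; rewrite lee_fin.
have [_ [A [finA _] <-]] := ub_ereal_sup_adherent e0 ffin.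
rewrite fsbig_finite // sumEFin -/(esum _ _) lteBlDr // => sup_lt.
exists (fset_set A) => F _; rewrite -lte_fin; apply: le_lt_trans sup_lt.
exact: fset_sum_le_esum.
Qed.

Lemma near_fset_filter (L : choiceType) (F0 : {fset L}) :
  \forall F \near fset_filter, (F0 `<=` F)%fset.
Proof. by exists F0. Qed.

(** Padding with zeros puts sums over [F0] and over [F] on one index set, where they can be compared
    term by term. *)
Lemma big_fset_if (V : nmodType) (L : choiceType) (f : L -> V)
    (F0 F : {fset L}) : (F0 `<=` F)%fset ->
  \sum_(i <- F) (if i \in F0 then f i else 0) = \sum_(i <- F0) f i.
Proof.
move=> F0F; rewrite -(big_fset_incl _ F0F) => [|i _ /negbTE -> //].
by rewrite big_seq [RHS]big_seq; apply: eq_bigr => i ->.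
Qed.

(** * Convergent expansions in an orthonormal family *)

Section Expansions.
Context {R : realType} {k : scalar_kind} {H : hilbertType R k}.
Context {L : choiceType} (u : L -> H).
Local Notation K := (scalar_field R k).
Local Notation psum xi F := (\sum_(i <- F) xi i *: u i).

Lemma ell2_bounded (xi : L -> K) (M : R) :
  (forall F : {fset L}, \sum_(i <- F) rnorm (xi i : K) ^+ 2 <= M) -> ell2 xi.
Proof.
move=> xiM; apply: le_lt_trans (ltry M); apply: esum_le_fset_sums => F.
by rewrite lee_fin.
Qed.

(** Eventually [phi x - c = phi (x - f t)], whose modulus is at most [M * rnorm (x - f t)] and hence
    arbitrarily small. *)
Lemma bounded_lim_eq (T : Type) (F : set_system T) {FF : ProperFilter F}
    (f : T -> H) (x : H) (phi : H -> K) (M : R) (c : K) :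
  (forall a b, phi (a - b) = phi a - phi b) ->
  (forall a, rnorm (phi a : K) <= M * rnorm a) ->
  f @ F --> x -> (\forall t \near F, phi (f t) = c) -> phi x = c.
Proof.
move=> phiB phiM /cvg_rnormP fx phif; apply/eqP.
rewrite -subr_eq0 -rnorm_eq0 eq_le rnorm_ge0 andbT.
apply/ler_addgt0Pr => e e0; rewrite add0r.
have M1 : 0 < `|M| + 1 by rewrite ltr_wpDl.
have /fx Fe : 0 < e / (`|M| + 1) by rewrite divr_gt0.
have [t [/= te <-]] := filter_ex (filterI Fe phif).
rewrite -phiB (le_trans (phiM _)) //.
apply: (@le_trans _ _ ((`|M| + 1) * rnorm (x - f t))).
  by rewrite ler_wpM2r ?rnorm_ge0 // (le_trans (ler_norm M)) // lerDl.
by rewrite mulrC -ler_pdivlMr // ltW.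
Qed.

Lemma psum_widen (xi : L -> K) (F0 F : {fset L}) : (F0 `<=` F)%fset ->
  psum (fun i => if i \in F0 then xi i else 0) F = psum xi F0.
Proof.
move=> F0F; rewrite -(big_fset_if _ F0F); apply: eq_bigr => i _.
by case: ifP; rewrite ?scale0r.
Qed.

Hypothesis u_on : orthonormal_family u.

(** Some finite combination over [F0] is close to [x]. Padded with zeros it competes on every [F]
    containing [F0], where the coefficients of [x] do at least as well. *)
Lemma psum_analysis_cvg x : closure (linear_span u) x ->
  psum (analysis u x) F @[F --> fset_filter] --> x.
Proof.
move=> /closure_rnormP clx; apply/cvg_rnormP => e /clx[_ [F0 [c ->]] xs].
apply: filterS (near_fset_filter F0) => F F0F; apply: le_lt_trans xs.
rewrite -rnormN opprB -[leRHS]rnormN opprB -(psum_widen _ F0F).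
exact: psum_best_approximation.
Qed.

(** By completeness a Cauchy estimate suffices: the squared distance between the sums over [F] and
    [F0] is the sum of [rnorm (xi i) ^+ 2] over the indices of [F] outside [F0], which
    [esum_adherent] makes small. *)
Lemma psum_cvg xi : ell2 xi ->
  psum xi F @[F --> fset_filter] --> synthesis u xi.
Proof.
move=> xi2; apply: cauchy_cvg; apply: cauchy_exP => e e0.
have r0 : 0 < real_part e.
  by rewrite -(@ltr_of_real _ k) rmorph0 -real_partK // ltW.
have r20 : 0 < real_part e ^+ 2 by rewrite exprn_gt0.
have [|F0 F0P] := esum_adherent _ xi2 r20; first by move=> i; exact: sqr_ge0.
exists (psum xi F0); apply: filterS (near_fset_filter F0) => F F0F.
rewrite -ball_normE /= norm_rnorm (real_partK (ltW e0)) ltr_of_real.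
rewrite -ltr_sqr ?nnegrE ?rnorm_ge0 ?(ltW r0) // -rnormN opprB.
rewrite -(psum_widen _ F0F) -sumrB.
under eq_bigr do rewrite -scalerBl.
rewrite rnorm_psum // -(ltrD2l (\sum_(i <- F0) rnorm (xi i : K) ^+ 2)).
apply: le_lt_trans (F0P _ F0F); rewrite -(big_fset_if _ F0F) -big_split /=.
apply: ler_sum => i _; case: ifP => _.
  by rewrite subrr rnorm0 expr0n addr0.
by rewrite subr0 add0r.
Qed.

(** The coefficient at [j] is constant as soon as the finite index set contains [j], and the inner
    product is continuous. *)
Lemma inner_synthesis xi j : ell2 xi -> inner (synthesis u xi) (u j) = xi j.
Proof.
move=> /psum_cvg xi_cvg.
apply: (bounded_lim_eq (phi := fun x => inner x (u j)) (M := rnorm (u j))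
  _ _ xi_cvg).
- by move=> a b; rewrite innerBl.
- by move=> a; rewrite mulrC cauchy_schwarz.
apply: filterS (near_fset_filter [fset j]%fset) => F; rewrite fsub1set => jF.
by rewrite inner_psum // jF.
Qed.

Lemma analysisK x : closure (linear_span u) x ->
  synthesis u (analysis u x) = x.
Proof. by move=> /psum_analysis_cvg; apply: cvg_lim; exact: norm_hausdorff. Qed.

Lemma analysis_ell2 x : ell2 (analysis u x).
Proof. by apply: ell2_bounded => F; exact: bessel. Qed.

End Expansions.

(** * Soft-thresholding and bounded operators *)

Section SoftThresholding.
Context {R : realType} {k : scalar_kind}.
Local Notation K := (scalar_field R k).
Implicit Types (a b : K) (t : R).

(** The real factor by which thresholding multiplies [b], so that [sign] disappears; at [b = 0] the
    convention [0^-1 = 0] makes it zero. *)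
Definition shrinkage b t : R := Num.max 0 (rnorm b - t) / rnorm b.

Lemma softE b t : soft b t = of_real (shrinkage b t) * b.
Proof.
rewrite /soft /sign /shrinkage; case: ifPn => [/eqP ->|b0].
  by rewrite mul0r mulr0.
by rewrite norm_rnorm rmorphM fmorphV /= -mulrA mulrC [_^-1 * _]mulrC.
Qed.

Lemma shrinkage_ge0 b t : 0 <= shrinkage b t.
Proof. by rewrite divr_ge0 ?rnorm_ge0 // le_max lexx. Qed.

Lemma shrinkage_le1 b t : 0 <= t -> shrinkage b t <= 1.
Proof.
move=> t0; rewrite /shrinkage; have [->|b0] := eqVneq (rnorm b) 0.
  by rewrite invr0 mulr0.
rewrite ler_pdivrMr ?mul1r; last by rewrite lt_def b0 rnorm_ge0.
by rewrite ge_max rnorm_ge0 /= gerBl.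
Qed.

Lemma shrinkage_eq0 b t : rnorm b <= t -> shrinkage b t = 0.
Proof. by move=> bt; rewrite /shrinkage max_l ?mul0r // subr_le0. Qed.

Lemma rnorm_soft b t : rnorm (soft b t) = shrinkage b t * rnorm b.
Proof. by rewrite softE rnormM rnorm_of_real ?shrinkage_ge0. Qed.

(* Strong convexity of [a |-> |a - b|^2 / 2 + t |a|] at its minimizer. *)
Lemma soft_minimizes a b t : 0 <= t ->
  2^-1 * rnorm (soft b t - b) ^+ 2 + t * rnorm (soft b t) +
    2^-1 * rnorm (a - soft b t) ^+ 2
  <= 2^-1 * rnorm (a - b) ^+ 2 + t * rnorm a.
Proof.
move=> t0; rewrite !rnormB_sqr_scalar rnorm_soft softE.
have -> : real_part (of_real (shrinkage b t) * b * conj b)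
    = shrinkage b t * rnorm b ^+ 2.
  by rewrite -mulrA real_partZ mul_conj real_part_of_real.
have -> : real_part (a * conj (of_real (shrinkage b t) * b))
    = shrinkage b t * real_part (a * conj b).
  by rewrite (rmorphM (@conj R k)) /= conj_of_real mulrCA real_partZ.
have := le_trans (ler_norm _) (real_part_le_norm (a * conj b)).
rewrite rnormM rnorm_conj; set p := real_part _ => pab.
have := rnorm_ge0 a; have := rnorm_ge0 b.
have := shrinkage_eq0 (b := b) (t := t).
rewrite /shrinkage; set N := rnorm b in pab *; set n := rnorm a in pab *.
move=> s0 N0 n0.
(* Below the threshold the soft value is zero and the claim reduces to [p <= t * n], which follows
   from [p <= n * N]. *)
have [Nt|tN] := leP N t.
  by rewrite (s0 Nt); nra.
rewrite max_r ?subr_ge0 ?(ltW tN) //.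
have N1 : 0 < N by exact: le_lt_trans tN.
set r := (N - t) / N.
have rN : r * N = N - t by rewrite /r; field; rewrite gt_eqF.
(* Once [r * N = N - t] is substituted, all other terms cancel and the claim is exactly this
   bound. *)
have pn : (1 - r) * p <= t * n.
  have -> : (1 - r) = t / N by rewrite /r; field; rewrite gt_eqF.
  by rewrite mulrAC ler_pdivrMr // -mulrA ler_wpM2l.
rewrite rN.
have -> : r * N ^+ 2 = (N - t) * N by rewrite expr2 mulrA rN.
nra.
Qed.

End SoftThresholding.

(** * Bounded operators, Riesz representation and the adjoint *)

Section BoundedOperators.
Context {R : realType} {k : scalar_kind} {X Y : hilbertType R k}.
Context (A : {linear X -> Y}).
Hypothesis A_bounded : bounded_operator A.
Local Notation K := (scalar_field R k).

Lemma bounded_operator_gt0 :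
  exists2 M : R, 0 < M & forall x, rnorm (A x) <= M * rnorm x.
Proof.
have [M AM] := A_bounded; exists (`|M| + 1); first by rewrite ltr_wpDl.
move=> x; apply: le_trans (AM x) _; rewrite ler_wpM2r ?rnorm_ge0 //.
by rewrite (le_trans (ler_norm M)) // lerDl.
Qed.

Lemma bounded_operator_cvg (T : Type) (F : set_system T) {FF : Filter F}
    (f : T -> X) (x : X) : f @ F --> x -> A (f t) @[t --> F] --> A x.
Proof.
have [M M0 AM] := bounded_operator_gt0.
move=> /cvg_rnormP fx; apply/cvg_rnormP => e e0.
have /fx : 0 < e / M by rewrite divr_gt0.
apply: filterS => t; rewrite ltr_pdivlMr // mulrC => ?.
by rewrite -linearB; apply: le_lt_trans (AM _) _.
Qed.

Context {L : choiceType} (u : L -> X).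
Hypothesis u_basis : orthonormal_basis u [set: X].

(** The coordinates of the representing vector are forced to be [conj (inner (A (u l)) y)];
    boundedness of [A] makes them square summable, so they can be synthesized. *)
Lemma riesz_representation (y : Y) :
  exists z, forall x, inner (A x) y = inner x z.
Proof.
have [M M0 AM] := bounded_operator_gt0; have [u_on u_total] := u_basis.
pose w l := conj (inner (A (u l)) y).
have AE xi (F : {fset L}) : inner (A (\sum_(i <- F) xi i *: u i)) y =
    \sum_(i <- F) xi i * conj (w i).
  rewrite linear_sum inner_suml; apply: eq_bigr => i _.
  by rewrite linearZ innerZl /w conjK.
have w2 : ell2 w.
  apply: (@ell2_bounded _ _ _ _ ((M * rnorm y) ^+ 2)) => F.
  set S := \sum_(i <- F) _.
  have S0 : 0 <= S by apply: sumr_ge0 => i _; exact: sqr_ge0.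
  (* At the partial sum with coefficients [w], of norm [p], the functional takes the value
     [S = p ^+ 2]. Boundedness gives [p ^+ 2 <= M * p * rnorm y], hence [p <= M * rnorm y]. *)
  have AS : inner (A (\sum_(i <- F) w i *: u i)) y = of_real S.
    rewrite AE rmorph_sum; apply: eq_bigr => i _; exact: mul_conj.
  have := cauchy_schwarz (A (\sum_(i <- F) w i *: u i)) y.
  rewrite AS rnorm_of_real // => SA.
  have := rnorm_psum u_on w F; rewrite -/S => Sp.
  have p0 := rnorm_ge0 (\sum_(i <- F) w i *: u i).
  have := le_trans SA (ler_wpM2r (rnorm_ge0 y) (AM _)).
  move: Sp p0; set p := rnorm _ => Sp p0; rewrite -Sp mulrAC.
  have [->|pn0] := eqVneq p 0; first by rewrite expr0n mulr0 sqr_ge0.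
  rewrite expr2 ler_pM2r; last by rewrite lt_def pn0.
  by move=> pM; rewrite !expr2 ler_pM.
exists (synthesis u w) => x; apply/eqP; rewrite -subr_eq0; apply/eqP.
have clx : closure (linear_span u) x by rewrite u_total.
(* The difference of the two functionals is bounded and vanishes on the partial sums of the
   expansion of [x], hence at [x]. *)
apply: (bounded_lim_eq (M := M * rnorm y + rnorm (synthesis u w))
    (phi := fun x => inner (A x) y - inner x (synthesis u w)) _ _
    (psum_analysis_cvg u_on clx)).
- move=> a b; rewrite linearB !innerBl; ring.
- move=> a; apply: le_trans (rnormD _ _) _; rewrite rnormN mulrDl lerD //.
    apply: le_trans (cauchy_schwarz _ _) _.
    by rewrite mulrAC ler_wpM2r ?rnorm_ge0.
  by rewrite mulrC cauchy_schwarz.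
apply: filterS (near_fset_filter fset0) => F _.
rewrite AE inner_psuml; apply/eqP; rewrite subr_eq0; apply/eqP.
by apply: eq_bigr => i _; rewrite inner_synthesis.
Qed.

(** [get] returns an element of its set once the set is known to be inhabited, which Riesz
    representation provides. *)
Lemma inner_adjoint x y : inner (A x) y = inner x (adjoint A y).
Proof.
have [z zP] := riesz_representation y.
exact: (@getPex _ [set z | forall x, inner (A x) y = inner x z]
  (ex_intro _ z zP)).
Qed.

End BoundedOperators.

Lemma eq_in_closure_span (R : realType) (k : scalar_kind) (H : hilbertType R k)
    (L : choiceType) (v : L -> H) (x y : H) : orthonormal_family v ->
  closure (linear_span v) x -> closure (linear_span v) y ->
  (forall l, inner x (v l) = inner y (v l)) -> x = y.
Proof.
move=> v_on clx cly xy; rewrite -(analysisK v_on clx) -(analysisK v_on cly).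
by congr synthesis; apply/funext.
Qed.

(** * The objective functional *)

Section SVD.
Context {R : realType} {k : scalar_kind} {X Y : hilbertType R k}.
Context {L : choiceType} (A : {linear X -> Y}).
Context (u : L -> X) (v : L -> Y) (kappa d : L -> R) (alpha c : R) (y : Y).
Hypotheses (A_bounded : bounded_operator A) (A_svd : is_svd A u v kappa).
Hypotheses (alpha_gt0 : 0 < alpha) (c_gt0 : 0 < c) (d_ge : forall l, c <= d l).
Local Notation K := (scalar_field R k).

Let u_on : orthonormal_family u := (svd_left A_svd).1.
Let v_on : orthonormal_family v := (svd_right A_svd).1.
Let kappa_gt0 : forall l, 0 < kappa l := svd_gt0 A_svd.

Let u_total x : closure (linear_span u) x.
Proof. by have [_ ->] := svd_left A_svd. Qed.

Lemma svd_inner x l : inner (A x) (v l) = of_real (kappa l) * inner x (u l).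
Proof.
rewrite (inner_adjoint A_bounded (svd_left A_svd)) (svd_adjoint A_svd).
by rewrite innerZr conj_of_real.
Qed.

Lemma svd_image l : A (u l) = of_real (kappa l) *: v l.
Proof.
have [_ v_total] := svd_right A_svd.
apply: (eq_in_closure_span v_on).
- by rewrite v_total; apply: subset_closure; exists (u l).
- apply: subset_closure; exists [fset l]%fset, (fun=> of_real (kappa l)).
  by rewrite big_seq_fset1.
move=> m; rewrite svd_inner u_on innerZl v_on.
by case: eqVneq => [->|_] //; rewrite !mulr0.
Qed.

Lemma svd_image_psum (xi : L -> K) (F : {fset L}) :
  A (\sum_(i <- F) xi i *: u i) =
  \sum_(i <- F) (of_real (kappa i) * xi i) *: v i.
Proof.
rewrite linear_sum; apply: eq_bigr => i _.
by rewrite linearZ /= svd_image scalerA mulrC.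
Qed.

(** * Thresholded coefficients and their square summability *)

Definition threshold_level l : R := alpha * d l / kappa l.

Definition soft_coef : L -> K :=
  mul_pinv kappa (soft_thresholding threshold_level (analysis v y)).

Let d_ge0 l : 0 <= d l. Proof. exact: le_trans (ltW c_gt0) (d_ge l). Qed.

Lemma threshold_level_ge0 l : 0 <= threshold_level l.
Proof. by rewrite divr_ge0 ?mulr_ge0 // ltW. Qed.

Lemma soft_ell2 : ell2 (soft_thresholding threshold_level (analysis v y)).
Proof.
apply: ell2_bounded => F; apply: le_trans (bessel v_on F y).
apply: ler_sum => l _; rewrite rnorm_soft exprMn.
rewrite ler_piMl ?sqr_ge0 // exprn_ile1 ?shrinkage_ge0 //.
by rewrite shrinkage_le1 ?threshold_level_ge0.
Qed.

(* Where the coefficient is nonzero, [alpha d_l / kappa_l < |y_l| <= |y|], so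
   that [1 / kappa_l] is bounded although [kappa] may tend to [0]. *)
Lemma soft_coef_ell2 : ell2 soft_coef.
Proof.
pose N := rnorm y.
(* Each coefficient is at most [N / (alpha * c)] times the modulus of [inner y (v l)], and Bessel's
   inequality contributes [N ^+ 2]. *)
apply: (@ell2_bounded _ _ _ _ ((N / (alpha * c)) ^+ 2 * N ^+ 2)) => F.
apply: le_trans (ler_wpM2l (sqr_ge0 _) (bessel v_on F y)).
rewrite mulr_sumr; apply: ler_sum => l _; rewrite -exprMn.
rewrite /soft_coef /mul_pinv /soft_thresholding /analysis.
set b : K := inner y (v l).
have k0 := kappa_gt0 l; have ac0 : 0 < alpha * c by rewrite mulr_gt0.
have NN : 0 <= N := rnorm_ge0 y.
rewrite -fmorphV /= rnormM rnorm_soft rnorm_of_real ?invr_ge0 ?(ltW k0) //.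
have Nac0 : 0 <= N / (alpha * c) * rnorm b.
  by rewrite mulr_ge0 ?rnorm_ge0 // divr_ge0 // ltW.
have s0 : 0 <= shrinkage b (threshold_level l) * rnorm b.
  by rewrite mulr_ge0 ?shrinkage_ge0 ?rnorm_ge0.
rewrite ler_sqr ?nnegrE //; last by rewrite mulr_ge0 // invr_ge0 ltW.
have [bt|tb] := leP (rnorm b) (threshold_level l).
  by rewrite shrinkage_eq0 // !mul0r.
have bN : rnorm b <= N.
  have := bessel v_on [fset l]%fset y; rewrite big_seq_fset1.
  by rewrite ler_sqr ?nnegrE ?rnorm_ge0.
have kN : (kappa l)^-1 <= N / (alpha * c).
  rewrite ler_pdivlMr //; apply: le_trans bN; apply: le_trans (ltW tb).
  rewrite /threshold_level mulrC ler_wpM2r ?invr_ge0 ?(ltW k0) //.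
  by rewrite ler_wpM2l // ltW.
rewrite mulrC; apply: ler_pM => //; first by rewrite invr_ge0 ltW.
by rewrite ler_piMl ?rnorm_ge0 // shrinkage_le1 ?threshold_level_ge0.
Qed.

(** * Comparison of the objective with its value at the candidate *)

Definition objective (x : X) : \bar R :=
  ((2^-1 * rnorm (A x - y) ^+ 2)%:E +
   alpha%:E * \esum_(l in [set: L]) (d l * rnorm (inner x (u l)))%:E)%E.

Definition minimizer : X := synthesis u soft_coef.

Lemma inner_minimizer l : inner minimizer (u l) = soft_coef l.
Proof. by rewrite inner_synthesis //; exact: soft_coef_ell2. Qed.

Let psum (xi : L -> K) (F : {fset L}) : X := \sum_(i <- F) xi i *: u i.

(** This is [soft_minimizes] summed over [F], at [a = kappa l * x_l]; the terms depending on the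
    data alone cancel. The penalties stand apart on the left because only the right side is known to
    converge along finite sets. *)
Lemma psum_objective_ge (x : X) (F : {fset L}) :
  alpha * (\sum_(l <- F) d l * rnorm (soft_coef l : K)
           - \sum_(l <- F) d l * rnorm (inner x (u l))) <=
  2^-1 * (rnorm (A (psum (analysis u x) F) - y) ^+ 2
          - rnorm (A (psum soft_coef F) - y) ^+ 2
          - rnorm (A (psum (analysis u x) F - psum soft_coef F)) ^+ 2).
Proof.
have -> : psum (analysis u x) F - psum soft_coef F =
    psum (fun l => analysis u x l - soft_coef l) F.
  by rewrite -sumrB; apply: eq_bigr => l _; rewrite scalerBl.
rewrite !svd_image_psum.
rewrite (rnorm_psum v_on) !(rnorm_sub_psum v_on) opprD addrACA subrr add0r.
rewrite -!sumrB !mulr_sumr; apply: ler_sum => l _.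
have k0 := kappa_gt0 l.
have ks : of_real (kappa l) * soft_coef l =
    soft (inner y (v l)) (threshold_level l).
  rewrite /soft_coef /mul_pinv mulrC divfK //.
  by rewrite fmorph_eq0 gt_eqF.
have := soft_minimizes (of_real (kappa l) * analysis u x l) (inner y (v l))
  (threshold_level_ge0 l).
(* The division by [kappa l] in the threshold undoes the scaling of the coordinate. *)
have tk z : threshold_level l * rnorm (of_real (kappa l) * z : K) =
    alpha * (d l * rnorm z).
  rewrite rnormM rnorm_of_real ?(ltW k0) // /threshold_level.
  by field; rewrite gt_eqF.
rewrite -ks -mulrBr !tk /analysis.
lra.
Qed.

Lemma objective_minimizer_le x :
  (objective minimizer + (2^-1 * rnorm (A (x - minimizer)) ^+ 2)%:E
   <= objective x)%E.
Proof.
rewrite /objective; set S := esum _ _; set T := esum _ _.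
have T0 : (0 <= T)%E.
  by apply: esum_ge0 => l _; rewrite lee_fin mulr_ge0 ?rnorm_ge0.
have S0 : (0 <= S)%E.
  by apply: esum_ge0 => l _; rewrite lee_fin mulr_ge0 ?rnorm_ge0.
(* An infinite penalty at [x] makes the right-hand side infinite. *)
have [Ty|Tfin] := eqVneq T +oo%E.
  by rewrite Ty gt0_muley ?lte_fin // addey // leey.
have {Tfin}Tfin : T \is a fin_num.
  by rewrite ge0_fin_numE // lt_neqAle Tfin leey.
pose G := 2^-1 * (rnorm (A x - y) ^+ 2 - rnorm (A minimizer - y) ^+ 2
          - rnorm (A (x - minimizer)) ^+ 2).
(* A real bound on all finite subsums of the penalty at the minimizer bounds [S] and shows it
   finite; rearranged, it is the claim. [G] is the limit of the right side of
   [psum_objective_ge]. *)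
have SG : (S <= ((G + alpha * fine T) / alpha)%:E)%E.
  rewrite /S; under eq_esum do rewrite inner_minimizer.
  apply: esum_le_fset_sums => F0; rewrite lee_fin ler_pdivlMr // -lerBlDr.
  have x_cvg := psum_analysis_cvg u_on (@u_total x).
  have m_cvg := psum_cvg u_on soft_coef_ell2.
  have r_cvg (f : {fset L} -> Y) z : f F @[F --> fset_filter] --> z ->
      rnorm (f F) ^+ 2 @[F --> fset_filter] --> rnorm z ^+ 2.
    by move=> fz; rewrite expr2; under eq_fun do rewrite expr2;
      apply: cvgM; exact: cvg_rnorm.
  have G_cvg : 2^-1 * (rnorm (A (psum (analysis u x) F) - y) ^+ 2
          - rnorm (A (psum soft_coef F) - y) ^+ 2
          - rnorm (A (psum (analysis u x) F - psum soft_coef F)) ^+ 2)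
      @[F --> fset_filter] --> G.
    apply: cvgM; first exact: cvg_cst.
    apply: cvgB; first apply: cvgB.
    - apply: r_cvg; apply: cvgB; last exact: cvg_cst.
      exact: bounded_operator_cvg.
    - apply: r_cvg; apply: cvgB; last exact: cvg_cst.
      exact: bounded_operator_cvg.
    - apply: r_cvg; apply: bounded_operator_cvg => //; exact: cvgB.
  (* For [F] containing [F0], the penalty of the minimizer over [F0] is at most that over [F], while
     [T] dominates the penalty of [x] over [F]. *)
  apply: (cvgr_to_ge G_cvg); apply: filterS (near_fset_filter F0) => F F0F.
  apply: le_trans (psum_objective_ge x F).
  rewrite mulrBr [_ * alpha]mulrC lerB // ler_pM2l //.
    rewrite -(big_fset_if _ F0F); apply: ler_sum => l _.
    by case: ifP => // _; rewrite mulr_ge0 ?rnorm_ge0.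
  rewrite -lee_fin fineK //; exact: fset_sum_le_esum.
have Sfin : S \is a fin_num by rewrite ge0_fin_numE // (le_lt_trans SG) ?ltry.
move: SG; rewrite -(fineK Sfin) -(fineK Tfin) -!EFinM -!EFinD !lee_fin.
by rewrite ler_pdivlMr // /G [_ * alpha]mulrC; lra.
Qed.

(** The competitor [0] has zero penalty and hence a finite objective. *)
Lemma objective_minimizer_fin : objective minimizer \is a fin_num.
Proof.
have obj0 : (objective 0%R < +oo)%E.
  rewrite /objective esum1; last first.
    by move=> l _; rewrite linear0l rnorm0 mulr0.
  by rewrite mule0 adde0 ltry.
have obj_ge0 : (0 <= objective minimizer)%E.
  apply: adde_ge0; first by rewrite lee_fin mulr_ge0 ?sqr_ge0 ?invr_ge0.
  apply: mule_ge0; first by rewrite lee_fin ltW.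
  by apply: esum_ge0 => l _; rewrite lee_fin mulr_ge0 ?rnorm_ge0.
rewrite ge0_fin_numE //; apply: le_lt_trans obj0.
apply: le_trans (objective_minimizer_le 0); rewrite leeDl // lee_fin.
by rewrite mulr_ge0 ?sqr_ge0 ?invr_ge0.
Qed.

(** Since [kappa l] is positive, [svd_inner] makes every coordinate of [x] vanish. *)
Lemma svd_injective x : A x = 0 -> x = 0.
Proof.
move=> Ax0; apply: (eq_in_closure_span u_on) => // l; rewrite linear0l.
have := svd_inner x l; rewrite Ax0 linear0l => /esym/eqP.
by rewrite mulf_eq0 fmorph_eq0 gt_eqF //= => /eqP.
Qed.

Lemma B_ana_minimizer : B_ana A u d alpha y = [set minimizer].
Proof.
apply/seteqP; split=> [x [_ x_min]|_ ->]; last first.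
  split=> // z _; apply: le_trans (objective_minimizer_le z); rewrite leeDl //.
  by rewrite lee_fin mulr_ge0 ?sqr_ge0 ?invr_ge0.
have := le_trans (objective_minimizer_le x) (x_min minimizer I).
(* The minimal value is finite and can be cancelled, leaving a squared norm that is at most zero. *)
rewrite -/(objective _) -[leRHS]adde0 leeD2lE ?objective_minimizer_fin //.
rewrite lee_fin pmulr_rle0 ?invr_gt0 // => Axm.
have /eqP : rnorm (A (x - minimizer)) ^+ 2 == 0.
  by rewrite eq_le Axm sqr_ge0.
move/eqP; rewrite sqrf_eq0 rnorm_eq0 => /eqP /svd_injective /eqP.
by rewrite subr_eq0 => /eqP.
Qed.

(** The coordinates of [synthesis u xi] are [xi], and every [x] is synthesized from its own
    coordinates, so the two objectives correspond. *)
Lemma B_syn_B_ana : B_syn A u d alpha y = B_ana A u d alpha y.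
Proof.
pose syn_objective (xi : L -> K) :=
  ((2^-1 * rnorm (A (synthesis u xi) - y) ^+ 2)%:E +
   alpha%:E * \esum_(l in [set: L]) (d l * rnorm (xi l : K))%:E)%E.
have objE xi : ell2 xi -> syn_objective xi = objective (synthesis u xi).
  move=> xi2; rewrite /syn_objective /objective.
  by under [in RHS]eq_esum do rewrite inner_synthesis //.
have objE' x : syn_objective (analysis u x) = objective x.
  by rewrite objE ?analysisK //; exact: analysis_ell2.
apply/seteqP; split=> [_ [xi [xi2 xi_min] <-]|x [_ x_min]].
  split=> // x _; have := xi_min _ (analysis_ell2 u_on x).
  by rewrite -!/(syn_objective _) objE // objE'.
exists (analysis u x); last exact: analysisK.
split; first exact: analysis_ell2.
move=> xi xi2; rewrite -!/(syn_objective _) objE' objE //; exact: x_min.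
Qed.

End SVD.

Theorem theorem3p6 (R : realType) (k : scalar_kind) (X Y : hilbertType R k)
    (A : {linear X -> Y}) (L : choiceType)
    (u : L -> X) (v : L -> Y) (kappa d : L -> R) (alpha : R) (ydelta : Y)
    (A_bounded : bounded_operator A)
    (A_svd : is_svd A u v kappa)
    (inf_d_gt0 : (0 < ereal_inf [set (d l)%:E | l in [set: L]])%E)
    (alpha_gt0 : 0 < alpha) :
  let threshold := soft_thresholding (fun l => alpha * d l / kappa l) in
  [/\ mul_pinv_dom kappa (threshold (analysis v ydelta)),
      B_ana A u d alpha ydelta = B_syn A u d alpha ydelta &
      B_syn A u d alpha ydelta =
        [set (synthesis u \o mul_pinv kappa \o threshold \o analysis v) ydelta]].
Proof.
have [c c_gt0 d_ge] : exists2 c, 0 < c & forall l, c <= d l.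
  have d_lb l : (ereal_inf [set (d l)%:E | l in [set: L]] <= (d l)%:E)%E.
    by apply: ereal_inf_lbound; exists l.
  (* A finite infimum serves as [c]. An infimum of [+oo] lies below no real [d l], so there is no
     index and any positive constant will do. *)
  case: ereal_inf inf_d_gt0 d_lb => [r| |] //= r0 d_lb.
    by exists r => // l; rewrite -lee_fin.
  by exists 1 => // l; have := d_lb l; rewrite leye_eq.
move=> threshold; split.
(* The domain condition is what makes the division by [kappa], possibly unbounded on [ell2],
   legitimate here. *)
- split; first exact: (soft_ell2 ydelta A_svd alpha_gt0 c_gt0 d_ge).
  exact: (soft_coef_ell2 ydelta A_svd alpha_gt0 c_gt0 d_ge).
- by rewrite (B_syn_B_ana d alpha ydelta A_svd).
by rewrite (B_syn_B_ana d alpha ydelta A_svd)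
  (B_ana_minimizer ydelta A_bounded A_svd alpha_gt0 c_gt0 d_ge).
Qed.
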